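(* Let $n \ge 1$ be an integer and let $(x,y,z)$ be a triple of positive integers with $x^n+y^n=z^n$. Then $(x,y) \in T_n(z;n)\cap[0,z]^2$; that is, $0\le x\le z$, $0\le y\le z$, and the pair of residue classes of $(x,y)$ modulo $z^n$ lies in $T_n(z;n)$.
   Context: $\mathbb{Z}_m=\mathbb{Z}/m\mathbb{Z}$. For positive integers $n, z, j$, the $j$-th Fermat tile of radius $z$ is $T_n(z;j):=\{(x,y) : x^n+y^n\equiv 0 \pmod{z^j}\}\subset(\mathbb{Z}_{z^j})^2$. The intersection $T_n(z;n)\cap[0,z]^2$ means the pairs of integers in $[0,z]^2$ whose residue classes modulo $z^n$ belong to $T_n(z;n)$. *)

(* Defs.v *)
From HB Require Import structures.
From mathcomp Require Import all_boot all_order all_algebra.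

Set Implicit Arguments.
Unset Strict Implicit.
Unset Printing Implicit Defensive.

Import Order.TTheory GRing.Theory Num.Theory.
Local Open Scope ring_scope.

(* The ring Z/mZ for every m >= 1.  The library's 'Z_m is Z/2Z when m = 1, so
   the ring structure is put on 'I_m.-1.+1 instead, whose multiplication is
   that of zmodp.v.  At m = 0 this type is the zero ring, not Z. *)
Definition Zmod (m : nat) : predArgType := 'I_m.-1.+1.

HB.instance Definition _ (m : nat) := Finite.on (Zmod m).
HB.instance Definition _ (m : nat) := GRing.Zmodule.on (Zmod m).
HB.instance Definition _ (m : nat) :=
  GRing.Zmodule_isComPzRing.Build (Zmod m)
    (@Zp_mulA _) (@Zp_mulC _) (@Zp_mul1z _) (@Zp_mul_addl _).

Definition fermat_tile (n z j : nat) : {set Zmod (z ^ j) * Zmod (z ^ j)} :=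
  [set p | p.1 ^+ n + p.2 ^+ n == 0].

Definition residue2 (m : nat) (p : int * int) : Zmod m * Zmod m :=
  (p.1%:~R, p.2%:~R).

(* T_n(z;n) \cap [0,z]^2, as a set of pairs of integers *)
Definition fermat_tile_box (n z : nat) : pred (int * int) :=
  [pred p | [&& 0 <= p.1 <= z%:Z, 0 <= p.2 <= z%:Z
              & residue2 (z ^ n) p \in fermat_tile n z n]].

(* Main.v *)
Require Import Defs.
From mathcomp Require Import all_boot all_order all_algebra.

(** For n >= 1 the n-th power is strictly increasing on naturals, so x^n, y^n <= z^n give x, y <= z.
    The sum x^n + y^n is z^n itself, the modulus, hence 0 by [natr_Zmod_self]. *)

Lemma natr_Zmod (m k : nat) :
  (k%:R : Zmod m)%R = inZp k.
Proof.
(* [k%:R] is by conversion a k-fold sum of [Zp1] in ['I_m.-1.+1]. The value of [Zp1] is 1 reduced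
   modulo [m.-1.+1], so 0 when m = 1. *)
apply: (etrans (Zp_mulrn (Zp1 : 'I_m.-1.+1) k)).
by apply: val_inj; rewrite /= modnMml mul1n.
Qed.

Lemma natr_Zmod_self (m : nat) : (0 < m)%N -> (m%:R : Zmod m)%R = 0%R.
Proof.
move=> m_gt0; rewrite natr_Zmod; apply: val_inj => /=.
by rewrite prednK // modnn.
Qed.

Theorem propositionA (n x y z : nat) (hn : (1 <= n)%N)
    (hx : (0 < x)%N) (hy : (0 < y)%N) (hz : (0 < z)%N)
    (hxyz : (x ^ n + y ^ n = z ^ n)%N) :
  (x%:Z, y%:Z)%R \in fermat_tile_box n z.
Proof.
have le_xz : (x <= z)%N by rewrite -(leq_exp2r _ _ hn) -hxyz leq_addr.
have le_yz : (y <= z)%N by rewrite -(leq_exp2r _ _ hn) -hxyz leq_addl.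
rewrite !inE /= !lez_nat le_xz le_yz /=.
(* Pull the integer casts back to one cast of the natural number x^n + y^n, where [hxyz] applies. *)
by rewrite -!pmulrn -!GRing.natrX -GRing.natrD hxyz natr_Zmod_self ?expn_gt0 ?hz.
Qed.
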